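(* Let $D=2^n$, let $|\chi\rangle \in \mathbb{C}^D$ be a quantum state (unit vector), let $U_1, U_2, U_3$ be unitary $D\times D$ matrices, and let $I, J \subset \{0,\ldots,D-1\}$ be such that all truncations below are defined, i.e. $P_I U_2U_1|\chi\rangle \neq 0$, $P_J U_1|\chi\rangle \neq 0$, and $P_I U_2 T_J(U_1|\chi\rangle) \neq 0$. Define $$|o\rangle = U_3U_2U_1|\chi\rangle,\qquad |o'\rangle = U_3\, T_I\big(U_2U_1|\chi\rangle\big),\qquad |o''\rangle = U_3\, T_I\big(U_2\, T_J(U_1|\chi\rangle)\big).$$ Then $$F(|o\rangle,|o''\rangle) = F(|o\rangle,|o'\rangle)\cdot F(|o'\rangle,|o''\rangle).$$
   Context: A quantum state on $n$ qubits is a vector of unit $\ell_2$-norm in $\mathbb{C}^D$, $D = 2^n$, with standard orthonormal basis $|0\rangle,\ldots,|D-1\rangle$. The fidelity of two quantum states is $F(|\psi\rangle,|\phi\rangle) = |\langle\psi|\phi\rangle|^2$, where $\langle\psi|\phi\rangle = (\psi^* )^{\mathrm T}\phi$ is the standard Hermitian inner product (conjugate-linear in the first argument). For $I \subset \{0,\ldots,D-1\}$ let $P_I = \sum_{i\in I} |i\rangle\langle i|$ be the orthogonal projection onto the coordinates in $I$. The truncation of a state $|\psi\rangle$ with $P_I|\psi\rangle\neq 0$ is $$T_I(|\psi\rangle) = \frac{P_I|\psi\rangle}{\|P_I|\psi\rangle\|_{\ell_2}}.$$ Here $|o\rangle$ is the exact output state of the circuit, $|o'\rangle$ the output with one approximation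 round, and $|o''\rangle$ the output with two approximation rounds. *)

(* Defs.v *)
From mathcomp Require Import all_boot all_order all_algebra.
From mathcomp Require Import complex.
From mathcomp Require Import reals.

Set Implicit Arguments.
Unset Strict Implicit.
Unset Printing Implicit Defensive.

Import Order.TTheory GRing.Theory Num.Theory.
Local Open Scope ring_scope.
Local Open Scope sesquilinear_scope.

Section Quantum.
Variables (C : numClosedFieldType) (D : nat).
Implicit Types (psi phi : 'cV[C]_D) (I : {set 'I_D}).

(* [dotmx] is not used because it acts on row vectors and is conjugate-linear
   in its second argument. *)
Definition braket psi phi : C := (psi ^t* *m phi) 0 0.

Definition l2norm psi : C := sqrtC (\sum_(i < D) `|psi i 0| ^+ 2).

Definition quantum_state psi : Prop := l2norm psi = 1.

(* The value is a nonnegative real, seen as an element of [C]. *)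
Definition fidelity psi phi : C := `|braket psi phi| ^+ 2.

Definition ket (i : 'I_D) : 'cV[C]_D := delta_mx i 0.

Definition coord_proj I : 'M[C]_D := \sum_(i in I) ket i *m (ket i) ^t*.

(* Meaningful only when [coord_proj I *m psi != 0]; otherwise it is [0]. *)
Definition truncation I psi : 'cV[C]_D :=
  (l2norm (coord_proj I *m psi))^-1 *: (coord_proj I *m psi).

End Quantum.

(* Main.v *)
(* Unitaries drop out of the fidelities.  With [P] the projection, [t] the
   truncation of [psi] and [x] any vector fixed by [P], self-adjointness of [P]
   gives <psi|x> = <P psi|x> = |P psi| <t|x>.  Taking [x = t] yields
   <psi|t> = |P psi|, so <psi|x> = <psi|t> <t|x>: fidelities multiply. *)

Require Import Defs.
From mathcomp Require Import all_boot all_order all_algebra.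
From mathcomp Require Import complex.
From mathcomp Require Import reals.

Set Implicit Arguments.
Unset Strict Implicit.
Unset Printing Implicit Defensive.

Import Order.TTheory GRing.Theory Num.Theory.
Local Open Scope ring_scope.
Local Open Scope sesquilinear_scope.

Section Quantum.
Variables (C : numClosedFieldType) (D : nat).
Implicit Types (psi phi : 'cV[C]_D) (I : {set 'I_D}).

Lemma adjmxM m n p (A : 'M[C]_(m, n)) (B : 'M[C]_(n, p)) :
  (A *m B) ^t* = B ^t* *m A ^t*.
Proof. by rewrite trmx_mul map_mxM. Qed.

Lemma braket_unitary (U : 'M[C]_D) psi phi :
  U \is unitarymx -> braket (U *m psi) (U *m phi) = braket psi phi.
Proof.
(* [unitarymxP] yields [U *m U ^t* = 1]; the other order is needed here, and it follows because [U]
   is square. *)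
move=> /unitarymxP /mulmx1C U_unitary.
by rewrite /braket adjmxM -mulmxA (mulmxA (U ^t*)) U_unitary mul1mx.
Qed.

Lemma braketZl (a : C) psi phi : braket (a *: psi) phi = a^* * braket psi phi.
Proof. by rewrite /braket linearZ /= map_mxZ -scalemxAl mxE. Qed.

Lemma braketZr (a : C) psi phi : braket psi (a *: phi) = a * braket psi phi.
Proof. by rewrite /braket -scalemxAr mxE. Qed.

Lemma braket_l2norm psi : braket psi psi = l2norm psi ^+ 2.
Proof.
rewrite /l2norm sqrtCK /braket mxE; apply: eq_bigr => i _.
by rewrite !mxE normCK mulrC.
Qed.

Lemma l2norm_ge0 psi : 0 <= l2norm psi.
Proof. by rewrite sqrtC_ge0 sumr_ge0 // => i _; rewrite exprn_ge0. Qed.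

Lemma l2norm_eq0 psi : (l2norm psi == 0) = (psi == 0).
Proof.
rewrite sqrtC_eq0 psumr_eq0 => [|i _]; last by rewrite exprn_ge0.
apply/allP/eqP => [psi0 | ->]; last by move=> i _; rewrite /= mxE normr0 expr0n eqxx.
apply/colP => i; rewrite mxE; have := psi0 i (mem_index_enum i).
by rewrite /= sqrf_eq0 normr_eq0 => /eqP.
Qed.

(** Seen entrywise, the sum of rank-one projectors is a 0/1 mask; idempotence and self-adjointness
    are then checked one coordinate at a time. *)
Lemma coord_projE I psi i : (coord_proj C I *m psi) i 0 = psi i 0 *+ (i \in I).
Proof.
have ketE j : ket C j *m (ket C j) ^t* *m psi = psi j 0 *: ket C j.
  rewrite /ket trmx_delta map_delta_mx -mulmxA -rowE.
  by apply/colP => k; rewrite !mxE big_ord1 !mxE andbT mulrC.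
rewrite mulmx_suml summxE; under eq_bigr do rewrite ketE !mxE andbT.
have [iI | iNI] := boolP (i \in I).
  rewrite (bigD1 i) //= eqxx mulr1 big1 ?addr0 // => j /andP[_ /negPf].
  by rewrite eq_sym => ->; rewrite mulr0.
rewrite big1 // => j jI; case: eqP => [ij | _]; last by rewrite mulr0.
by rewrite ij jI in iNI.
Qed.

Lemma coord_proj_idem I psi :
  coord_proj C I *m (coord_proj C I *m psi) = coord_proj C I *m psi.
Proof. by apply/colP => i; rewrite !coord_projE -mulrnA mulnb andbb. Qed.

Lemma braket_coord_proj I psi phi :
  braket psi (coord_proj C I *m phi) = braket (coord_proj C I *m psi) phi.
Proof.
rewrite /braket !mxE; apply: eq_bigr => i _.
rewrite [in LHS]coord_projE [X in _ = X * _]mxE [X in _ = X^* * _]mxE coord_projE.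
(* The mask is real: conjugation fixes 0, so both sides vanish off [I] and agree on it. *)
by rewrite !mxE; case: (i \in I); rewrite ?rmorph0 ?mulr0 ?mul0r.
Qed.

Lemma coord_proj_truncation I psi :
  coord_proj C I *m truncation I psi = truncation I psi.
Proof. by rewrite /truncation -scalemxAr coord_proj_idem. Qed.

Lemma braket_truncation I psi phi :
    coord_proj C I *m psi != 0 -> coord_proj C I *m phi = phi ->
  braket psi phi = l2norm (coord_proj C I *m psi) * braket (truncation I psi) phi.
Proof.
move=> psiI_neq0 phiI; rewrite -{1}phiI braket_coord_proj braketZl.
(* The scalar pulled out of the left argument is an inverse norm, hence real: its conjugate is
   itself, and it cancels the norm in front. *)
by rewrite geC0_conj ?invr_ge0 ?l2norm_ge0 // mulVKf // l2norm_eq0.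
Qed.

Lemma braket_truncation_self I psi :
  coord_proj C I *m psi != 0 ->
  braket psi (truncation I psi) = l2norm (coord_proj C I *m psi).
Proof.
(* Doubling the projection leaves one copy on the right after the other moves left, so the braket
   becomes a squared norm. The copies doubled inside the norms are merged again below. *)
move=> psiI_neq0; rewrite braketZr -coord_proj_idem braket_coord_proj.
by rewrite braket_l2norm coord_proj_idem expr2 mulKf // l2norm_eq0.
Qed.

Lemma fidelity_truncation I psi phi :
    coord_proj C I *m psi != 0 -> coord_proj C I *m phi = phi ->
  fidelity psi phi =
    fidelity psi (truncation I psi) * fidelity (truncation I psi) phi.
Proof.
move=> psiI_neq0 phiI; rewrite /fidelity -exprMn -normrM.
by rewrite braket_truncation_self // -braket_truncation.
Qed.

End Quantum.

Theorem mainTheorem2 (R : realType) (n : nat)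
    (chi : 'cV[R[i]]_(2 ^ n)%N) (U1 U2 U3 : 'M[R[i]]_(2 ^ n)%N)
    (I J : {set 'I_(2 ^ n)%N})
    (chi_state : quantum_state chi)
    (U1_unitary : U1 \is unitarymx)
    (U2_unitary : U2 \is unitarymx)
    (U3_unitary : U3 \is unitarymx)
    (PI_neq0 : coord_proj R[i] I *m (U2 *m U1 *m chi) != 0)
    (PJ_neq0 : coord_proj R[i] J *m (U1 *m chi) != 0)
    (PIJ_neq0 : coord_proj R[i] I *m (U2 *m truncation J (U1 *m chi)) != 0) :
  let o := U3 *m U2 *m U1 *m chi in
  let o' := U3 *m truncation I (U2 *m U1 *m chi) in
  let o'' := U3 *m truncation I (U2 *m truncation J (U1 *m chi)) in
  fidelity o o'' = fidelity o o' * fidelity o' o''.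
Proof.
(* Reassociation puts [U3] in front of all three states, ready to cancel, and groups [U2 *m U1] as
   in [PI_neq0]. *)
move=> o o' o''; rewrite /o /o' /o'' -!mulmxA !(mulmxA U2) /fidelity.
rewrite !braket_unitary //; apply: fidelity_truncation => //.
(* The last truncation in [o''] is onto the same [I] as in [o'], so the projection onto [I] fixes
   it. *)
exact: coord_proj_truncation.
Qed.
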